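(* For every $\lambda>0$ there exists $c=c(\lambda)>0$ such that the following holds. Let $G$ be a graph with average degree $d$ whose adjacency matrix has smallest eigenvalue at least $-\lambda$. Then $G$ contains a clique of size at least $c\,d$ (i.e. of size $\Omega_\lambda(d)$).
   Context: Graphs are finite and simple; the eigenvalues of $G$ are those of its (symmetric) adjacency matrix. *)

(* Defs.v *)
From mathcomp Require Import all_boot all_order all_algebra.
From mathcomp Require Import reals.

Set Implicit Arguments.
Unset Strict Implicit.
Unset Printing Implicit Defensive.

Import Order.TTheory GRing.Theory Num.Theory.
Local Open Scope ring_scope.

Definition simple_graph (V : finType) (e : rel V) : Prop :=
  symmetric e /\ irreflexive e.

Definition degree (V : finType) (e : rel V) (x : V) : nat :=
  #|[set y | e x y]|.

(* On the empty vertex type this is 0 / 0 = 0. *)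
Definition average_degree (R : realType) (V : finType) (e : rel V) : R :=
  (\sum_(x : V) degree e x)%:R / #|V|%:R.

(* Matrices are indexed by ordinals, so vertices are numbered by [enum_val];
   another numbering conjugates the matrix by a permutation matrix and leaves
   the eigenvalues unchanged. *)
Definition adjacency_matrix (R : realType) (V : finType) (e : rel V) :
    'M[R]_#|V| :=
  \matrix_(i, j) (e (enum_val i) (enum_val j))%:R.

Definition is_smallest_eigenvalue (R : realType) (n : nat) (A : 'M[R]_n)
    (mu : R) : Prop :=
  eigenvalue A mu /\ forall nu : R, eigenvalue A nu -> mu <= nu.

Definition clique (V : finType) (e : rel V) (K : {set V}) : Prop :=
  {in K &, forall x y, x != y -> e x y}.

(* Main.v *)
Require Import Defs.
From mathcomp Require Import all_boot all_order all_algebra.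
From mathcomp Require Import reals complex spectral ring lra zify.
Import Order.TTheory GRing.Theory Num.Theory.
Local Open Scope ring_scope.

(** The matrix [A + lambda I] is positive semidefinite, hence the Gram
    matrix of vectors [u_v] with [<u_v, u_w> = 1] if [v ~ w] and [0] otherwise.
    Let [N] be the neighbourhood of a vertex of maximal degree. If a vertex [w]
    of a set [S] inside [N] has a positive proportion of both neighbours [A] and
    non-neighbours [B] in [S], the barycentres of [A] and [B] are at distance at
    least [1 / (2 sqrt lambda)], so one of them has noticeably larger norm than
    the barycentre of [S]. These norms are bounded, so iterating yields a [T] of
    linear size in which each vertex is joined to almost all or almost none of
    [T]. The Gram vector of the centre of [N] keeps the barycentre of [T] away
    from [0], so the set [H] of vertices of the first kind has linear size, and
    the complement of [H] is sparse. Projecting away the barycentre of the common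
    neighbours of a vertex and its non-neighbours in [H] turns these into a large
    star with entries [-1], so vertices of [H] have boundedly many
    non-neighbours, and a maximal clique of [H] has linear size. *)

(** * The quadratic form of a symmetric matrix and its eigenvalues *)

Section Spectral.
Local Open Scope sesquilinear_scope.
Local Open Scope complex_scope.

(** Over [R[i]] the matrix is Hermitian, so a unitary change of basis turns the form into a sum of
    squared moduli weighted by eigenvalues. *)
Lemma symmetric_form_ge (R : rcfType) (n : nat) (A : 'M[R]_n) (mu : R) :
  A^T = A -> (forall nu, eigenvalue A nu -> mu <= nu) ->
  forall x : 'rV[R]_n, mu * (x *m x^T) 0 0 <= (x *m A *m x^T) 0 0.
Proof.
move=> Asym mu_min x; pose B := A ^ (real_complex R).
have realC (y : R) : y%:C \is Num.real by rewrite complex_real.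
have Bherm : B \is hermsymmx.
  apply: realsym_hermsym; first by apply/is_hermitianmxP;
    rewrite expr0 scale1r map_mx_id // /B map_trmx Asym.
  by apply/mxOverP => i j; rewrite mxE.
have /hermitian_normalmx/orthomx_spectralP := Bherm.
have /mxOverP Dreal := hermitian_spectral_diag_real Bherm.
have Punit := spectral_unitarymx B.
move: (spectralmx B) (spectral_diag B) Dreal Punit => P D Dreal Punit BE.
have Pinv := unitarymx_unit Punit.
(* Each diagonal entry is real, hence an eigenvalue of [A] over [R] itself; row [i] of [P] is an
   eigenvector of [B], nonzero because [P] is unitary. *)
have D_ge i : mu%:C <= D 0 i.
  have /complex_realP[k Dk] := Dreal 0 i.
  rewrite Dk lecR; apply: mu_min; rewrite -(eigenvalue_map (real_complex R)).
  apply/eigenvalueP; exists (row i P).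
    rewrite -/B {1}BE -mulmxA -row_mul mulKVmx // row_mul row_diag_mx.
    by rewrite -scalemxAl -rowE Dk.
  apply/eqP => Pi0; have /matrixP/(_ i i) := unitarymxP Punit.
  rewrite !mxE eqxx big1 => [/eqP|j _]; first by rewrite eq_sym oner_eq0.
  by have /rowP/(_ j) := Pi0; rewrite !mxE => ->; rewrite mul0r.
pose y := x ^ (real_complex R); pose z := y *m P^t*.
have yT : y^t* = (x^T) ^ (real_complex R).
  by apply/matrixP => i j; rewrite !mxE conj_Creal.
have zT : z^t* = P *m y^t*.
  by rewrite /z trmx_mul map_mxM trmxCK.
have normE : (x *m x^T) ^ (real_complex R) = z *m z^t*.
  by rewrite zT mulmxA /z mulmxKtV // map_mxM -yT.
have formE : (x *m A *m x^T) ^ (real_complex R) = z *m diag_mx D *m z^t*.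
  by rewrite zT !mulmxA !map_mxM -yT -/y -/B {1}BE invmx_unitary // !mulmxA.
rewrite -lecR rmorphM /=.
have /matrixP/(_ 0 0) := normE; rewrite [in LHS]mxE => ->.
have /matrixP/(_ 0 0) := formE; rewrite [in LHS]mxE => ->.
rewrite !mxE mulr_sumr; apply: ler_sum => i _; rewrite mul_mx_diag !mxE.
by rewrite mulrAC [leRHS]mulrC ler_wpM2r ?mul_conjC_ge0.
Qed.

End Spectral.

Lemma leq_card_bigcup (I T : finType) (A : {set I}) (F : I -> {set T}) (m : nat) :
  (forall i, i \in A -> (#|F i| <= m)%N) ->
  (#|\bigcup_(i in A) F i| <= m * #|A|)%N.
Proof.
move=> Fm; rewrite mulnC -sum_nat_const.
elim/big_rec2: _ => [|i n U iA IH]; first by rewrite cards0.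
by rewrite (leq_trans (leq_card_setU _ _)) // leq_add ?Fm.
Qed.

(** * Gram products of vertex sets *)

Section Gram.
Variables (R : realFieldType) (V : finType) (e : rel V) (l : nat).
Hypotheses (esym : symmetric e) (eirr : irreflexive e).
Hypothesis psd : forall x : V -> R,
  0 <= \sum_u \sum_v x u * x v * ((e u v)%:R + l%:R * (u == v)%:R).

Definition nbr (w : V) : {set V} := [set y | e w y].

(** The inner product of the sums of the Gram vectors over [X] and over [Y], the integer [l] taking
    the place of [lambda]. *)
Definition gram (X Y : {set V}) : R :=
  \sum_(u in X) \sum_(v in Y) ((e u v)%:R + l%:R * (u == v)%:R).

Lemma gramC X Y : gram X Y = gram Y X.
Proof.
rewrite /gram exchange_big; apply: eq_bigr => u _; apply: eq_bigr => v _.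
by rewrite esym eq_sym.
Qed.

Lemma gramE X Y :
  gram X Y = \sum_(u in X) (#|Y :&: nbr u|%:R + l%:R * (u \in Y)%:R).
Proof.
apply: eq_bigr => u _; rewrite big_split /=; congr (_ + _).
  rewrite -natr_sum -big_mkcondr /= sum1_card; congr (_%:R).
  by apply: eq_card => v; rewrite !inE.
rewrite -mulr_sumr; congr (_ * _); case: (boolP (u \in Y)) => uY.
  rewrite (bigD1 u) //= eqxx big1 ?addr0 // => v /andP[_ /negPf vu].
  by rewrite eq_sym vu.
by rewrite big1 // => v vY; case: eqP => // uv; rewrite uv vY in uY.
Qed.

Lemma gram1l w Y : gram [set w] Y = #|Y :&: nbr w|%:R + l%:R * (w \in Y)%:R.
Proof. by rewrite gramE big_set1. Qed.

Lemma gram_setID Y S :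
  gram S S = gram (S :&: Y) (S :&: Y) + gram (S :\: Y) (S :\: Y)
             + 2 * gram (S :&: Y) (S :\: Y).
Proof.
have splitr X : gram X S = gram X (S :&: Y) + gram X (S :\: Y).
  by rewrite -big_split; apply: eq_bigr => u _; apply: big_setID.
have splitl X : gram S X = gram (S :&: Y) X + gram (S :\: Y) X.
  exact: big_setID.
rewrite splitl !splitr (gramC (S :\: Y) (S :&: Y)); ring.
Qed.

Lemma gram_le S : gram S S <= #|S|%:R ^+ 2 + l%:R * #|S|%:R.
Proof.
rewrite gramE big_split /=; apply: lerD.
  rewrite expr2 mulr_natl -sumr_const; apply: ler_sum => u _.
  by rewrite ler_nat subset_leq_card ?subsetIl.
rewrite mulr_natr -sumr_const; apply: ler_sum => u ->; by rewrite mulr1.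
Qed.

(** Positive semidefiniteness tested on a combination of three indicator functions; the geometric
    inequalities below are choices of sets and coefficients. *)
Lemma gram_ge0 X Y Z (a b c : R) :
  0 <= a ^+ 2 * gram X X + b ^+ 2 * gram Y Y + c ^+ 2 * gram Z Z
       + 2 * (a * b * gram X Y + a * c * gram X Z + b * c * gram Y Z).
Proof.
pose ind (S : {set V}) v : R := (v \in S)%:R.
have gramI S T : gram S T = \sum_u \sum_v
    ind S u * ind T v * ((e u v)%:R + l%:R * (u == v)%:R).
  rewrite /gram big_mkcond; apply: eq_bigr => u _; rewrite /ind.
  case: (u \in S); last by rewrite big1 // => v _; rewrite !mul0r.
  rewrite big_mkcond; apply: eq_bigr => v _.
  by case: (v \in T); rewrite ?mul1r ?mul0r ?mulr0.
apply: le_trans (psd (fun v => a * ind X v + b * ind Y v + c * ind Z v)) _.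
have -> : a ^+ 2 * gram X X + b ^+ 2 * gram Y Y + c ^+ 2 * gram Z Z
       + 2 * (a * b * gram X Y + a * c * gram X Z + b * c * gram Y Z) =
       a ^+ 2 * gram X X + b ^+ 2 * gram Y Y + c ^+ 2 * gram Z Z
       + (a * b * gram X Y + a * b * gram Y X)
       + (a * c * gram X Z + a * c * gram Z X)
       + (b * c * gram Y Z + b * c * gram Z Y).
  rewrite (gramC Y X) (gramC Z X) (gramC Z Y); ring.
rewrite !gramI !mulr_sumr -!big_split /=; apply: ler_sum => u _.
rewrite !mulr_sumr -!big_split /=; apply: ler_sum => v _.
rewrite le_eqVlt; apply/orP; left; apply/eqP; ring.
Qed.

(** * Energy increments inside a neighbourhood *)

Hypothesis l_gt0 : (0 < l)%N.

Let lR_gt0 : 0 < l%:R :> R. Proof. by rewrite ltr0n. Qed.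

(** Cauchy-Schwarz for the Gram vector of [v], of squared norm [l], and the sum over [S]: their
    product is [#|S|]. *)
Lemma gram_nbr_ge v (S : {set V}) : S \subset nbr v -> #|S|%:R ^+ 2 <= l%:R * gram S S.
Proof.
move=> /[dup] /setIidPl SN /subsetP Sv.
have vS : v \notin S by apply/negP => /Sv; rewrite inE eirr.
have := gram_ge0 [set v] S S (- #|S|%:R) l%:R 0.
rewrite !gram1l SN (negPf vS) set11.
have -> : [set v] :&: nbr v = set0.
  by apply/setP => x; rewrite !inE; case: eqP => [->|//]; rewrite eirr.
rewrite cards0 !(mulr1, mulr0, addr0, add0r, expr0n, mul0r) -(ler_pM2l lR_gt0).
move: #|S|%:R => s. lra.
Qed.

(* If [w] is joined to all of [A] and to none of [B], its Gram vector separates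
   the barycentres of [A] and [B]; the inequality is cleared of denominators. *)
Lemma gram_split w (S : {set V}) (A := S :&: nbr w) (B := S :\: nbr w) :
  (2 * l <= #|B|)%N ->
  #|A|%:R ^+ 2 * #|B|%:R ^+ 2 <= 4 * l%:R *
    (#|B|%:R ^+ 2 * gram A A + #|A|%:R ^+ 2 * gram B B
      - 2 * #|A|%:R * #|B|%:R * gram A B).
Proof.
move=> lB.
have AI : A :&: nbr w = A by rewrite /A -setIA setIid.
have BI : B :&: nbr w = set0.
  by apply/setP => x; rewrite !inE; case: (e w x); rewrite ?andbF.
have wA : w \notin A by rewrite !inE eirr andbF.
have wI : [set w] :&: nbr w = set0.
  by apply/setP => x; rewrite !inE; case: eqP => [->|//]; rewrite eirr.
(* The last two coefficients give [#|A| * #|B|] times the difference of the barycentres. Its product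
   with the vector of [w] is at least [#|A| * #|B| / 2], even if [w] lies in [B], since
   [2 * l <= #|B|]; the first coefficient is optimal for that value. *)
have := gram_ge0 [set w] A B (- (#|A|%:R * #|B|%:R / (2 * l%:R))) #|B|%:R (- #|A|%:R).
rewrite !gram1l AI BI wI (negPf wA) set11 !cards0 !(mulr1, mulr0, addr0, add0r).
set p := #|A|%:R; set q := #|B|%:R; set L := l%:R.
have p0 : 0 <= p by rewrite ler0n.
have q0 : 2 * L <= q by rewrite /L /q -natrM ler_nat.
set a := p * q / (2 * L).
have aE : 2 * L * a = p * q by rewrite /a; field; rewrite lt0r_neq0.
have a0 : 0 <= a by rewrite divr_ge0 ?mulr_ge0 ?ler0n.
have aa : 4 * L * (L * a ^+ 2) = p ^+ 2 * q ^+ 2.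
  rewrite -exprMn -aE; ring.
have apq : 4 * L * (a * p * q) = 2 * (p ^+ 2 * q ^+ 2).
  rewrite (_ : 4 * L * _ = 2 * (2 * L * a) * (p * q)); last by ring.
  by rewrite aE; ring.
have pqw : 4 * L * (a * p * (L * (w \in B)%:R)) <= p ^+ 2 * q ^+ 2.
  rewrite (_ : 4 * L * _ = 2 * L * a * p * (2 * L) * (w \in B)%:R); last by ring.
  rewrite aE; case: (w \in B); last by rewrite mulr0 mulr_ge0 ?sqr_ge0.
  rewrite mulr1 (_ : p ^+ 2 * q ^+ 2 = p * q * p * q); last by ring.
  by rewrite ler_wpM2l ?mulr_ge0.
have L4 : 0 <= 4 * L by rewrite mulr_ge0 ?ler0n.
move=> /(mulr_ge0 L4); lra.
Qed.

(* The energy of [S] is [gram S S / #|S| ^ 2], which is at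
   most [2]; the hypothesis says that at most [k] increments are left. *)
Lemma energy_increment (D k : nat) (S : {set V}) : (1 < D)%N ->
    (2 * l * D ^ k <= #|S|)%N ->
    (2 - k%:R / (8 * l%:R * D%:R)) * #|S|%:R ^+ 2 < gram S S ->
  exists T : {set V}, [/\ T \subset S, (#|S| <= D ^ k * #|T|)%N &
    forall w, w \in T ->
      (D * #|T :&: nbr w| <= #|T|)%N \/ (D * #|T :\: nbr w| <= #|T|)%N].
Proof.
move=> D1; have D0 : 0 < D%:R :> R by rewrite ltr0n; lia.
have lD0 : 0 < 8 * l%:R * D%:R :> R by rewrite !mulr_gt0 // ltr0n.
elim: k S => [|k IHk] S sS energy.
  (* With no increment left the energy would exceed [2], but it is at most
     [1 + l / #|S| <= 3 / 2]. *)
  have := gram_le S; rewrite expn0 muln1 in sS; rewrite mul0r subr0 in energy.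
  have lS : 2 * l%:R <= #|S|%:R :> R by rewrite -natrM ler_nat.
  have := ler_wpM2l (ler0n R #|S|) lS; have := sqr_ge0 (#|S|%:R : R).
  by move: #|S|%:R energy => m; lra.
case: (boolP [forall w in S, (D * #|S :&: nbr w| <= #|S|)
                             || (D * #|S :\: nbr w| <= #|S|)]%N).
  move=> /forall_inP good; exists S; split=> //.
    by rewrite leq_pmull // expn_gt0; lia.
  by move=> w /good/orP.
rewrite negb_forall => /existsP[w]; rewrite negb_imply negb_or -!ltnNge.
case/and3P=> wS; set A := S :&: nbr w; set B := S :\: nbr w => bigA bigB.
have cS : #|S| = (#|A| + #|B|)%N by rewrite cardsID.
have Dk0 : (0 < D ^ k)%N by rewrite expn_gt0; lia.
(* A part whose energy passes the next threshold uses up one increment and one factor [D] in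
   size. *)
have sub (T : {set V}) : T \subset S -> (#|S| < D * #|T|)%N ->
    (2 - k%:R / (8 * l%:R * D%:R)) * #|T|%:R ^+ 2 < gram T T ->
    exists T : {set V}, [/\ T \subset S, (#|S| <= D ^ k.+1 * #|T|)%N &
    forall w, w \in T ->
      (D * #|T :&: nbr w| <= #|T|)%N \/ (D * #|T :\: nbr w| <= #|T|)%N].
  move=> TS bigT eT; have [|//|T' [T'T sT' gT']] := IHk T.
    rewrite -(leq_pmul2l (_ : 0 < D)%N); last by lia.
    by rewrite mulnCA -expnS (leq_trans sS) // ltnW.
  exists T'; split=> //; first exact: subset_trans T'T TS.
  by rewrite expnS -mulnA (leq_trans (ltnW bigT)) // leq_mul2l sT' orbT.
case: (ltP ((2 - k%:R / (8 * l%:R * D%:R)) * #|A|%:R ^+ 2) (gram A A)) => [eA|eA].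
  by apply: (sub A) => //; apply: subsetIl.
case: (ltP ((2 - k%:R / (8 * l%:R * D%:R)) * #|B|%:R ^+ 2) (gram B B)) => [eB|eB].
  by apply: (sub B) => //; apply: subsetDl.
exfalso.
have lB : (2 * l <= #|B|)%N.
  rewrite expnS mulnCA in sS; have : (D * (2 * l) <= D * #|B|)%N.
    apply: leq_trans (ltnW bigB); apply: leq_trans sS.
    by rewrite leq_mul2l leq_pmulr ?orbT.
  by rewrite leq_pmul2l //; lia.
have := gram_split w S lB; rewrite -/A -/B.
move: energy; rewrite (gram_setID (nbr w)) -/A -/B cS natrD.
rewrite -[k.+1%:R]natr1 [(k%:R + 1) / _]mulrDl mul1r opprD addrA.
have : (#|A| + #|B|)%:R <= D%:R * #|A|%:R :> R by rewrite -natrM ler_nat -cS ltnW.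
have : (#|A| + #|B|)%:R <= D%:R * #|B|%:R :> R by rewrite -natrM ler_nat -cS ltnW.
rewrite natrD.
have p0 : 0 < #|A|%:R :> R by rewrite ltr0n; case: #|A| bigA => //; rewrite muln0.
have q0 : 0 < #|B|%:R :> R by rewrite ltr0n; case: #|B| bigB => //; rewrite muln0.
move: eA eB; set r := 2 - _ => eA eB.
move: p0 q0 eA eB; set p := #|A|%:R; set q := #|B|%:R.
move: (gram A A) (gram B B) (gram A B) => a b c p0 q0 eA eB Bbig Abig.
set h := (8 * _ * _)^-1 => energy separated.
have hE : 8 * l%:R * D%:R * h = 1 by rewrite divff // gt_eqF.
have h0 : 0 < h by rewrite invr_gt0.
have pq0 : 0 < p * q by rewrite mulr_gt0.
(* The energy of [S] is the weighted mean of those of [A] and [B] minus a multiple of the squared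
   distance of their barycentres; as neither part gains [h], that distance is small. *)
have bound : q ^+ 2 * a + p ^+ 2 * b - 2 * p * q * c < p * q * h * (p + q) ^+ 2.
  have := ler_wpM2l (ltW (mulr_gt0 q0 (addr_gt0 p0 q0))) eA.
  have := ler_wpM2l (ltW (mulr_gt0 p0 (addr_gt0 p0 q0))) eB.
  have := energy; rewrite -(ltr_pM2l pq0); lra.
have := le_lt_trans separated (_ : _ < 4 * l%:R * (p * q * h * (p + q) ^+ 2)).
rewrite ltr_pM2l ?mulr_gt0 ?ltr0n // => /(_ bound).
rewrite -(ltr_pM2l (_ : 0 < 2 * D%:R)) ?mulr_gt0 //.
rewrite (_ : _ * (4 * _ * _) = (8 * l%:R * D%:R * h) * (p * q) * (p + q) ^+ 2); last by ring.
rewrite hE mul1r (_ : _ * (_ * _) = (p * q) * (2 * D%:R * p * q)); last by ring.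
rewrite ltr_pM2l //.
(* What remains is [2 D p q < (p + q) ^ 2], against [p + q <= D p] and [p + q <= D q]. *)
have := ler_wpM2r (ltW p0) Bbig; have := ler_wpM2r (ltW q0) Abig; lra.
Qed.

(** * From a dense set to a clique *)

(** Otherwise [k] non-neighbours of [w] form a set [B]. Modulo the barycentre of the common
    neighbours [C], the vector of [w] has product about [-1] with each vertex of [B], and distinct
    vertices of [B] have essentially nonpositive products; [k > 2 * l ^ 2] rules this out. *)
Lemma few_nonneighbours (H : {set V}) (k := (2 * l ^ 2 + 1)%N) :
    (8 * k <= #|H|)%N ->
    (forall w, w \in H -> (2 * k.+1 * #|H :\: nbr w| <= #|H|)%N) ->
  forall w, w \in H -> (#|H :\: nbr w| <= k)%N.
Proof.
move=> bigH sparse w wH; rewrite leqNgt; apply/negP => manyw.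
(* By irreflexivity [w] is counted in [H :\: nbr w], so at least [k] elements remain without it. *)
have [B BH cB] : exists2 B : {set V}, B \subset (H :\: nbr w) :\ w & #|B| = k.
  have : (0 < #|[set B : {set V} | B \subset (H :\: nbr w) :\ w & #|B| == k]|)%N.
    rewrite cards_draws bin_gt0; have := cardsD1 w (H :\: nbr w).
    by rewrite !inE eirr wH; lia.
  by case/card_gt0P => B; rewrite inE => /andP[BH /eqP cB]; exists B.
have /subsetP BHw := BH.
pose C := H :\: \bigcup_(b in w |: B) (H :\: nbr b).
have Cnbr b : b \in w |: B -> C :&: nbr b = C.
  move=> bB; apply/setIidPl/subsetP => c /setDP[cH]; apply: contraR => cb.
  by apply/bigcupP; exists b => //; rewrite inE cb.
have BinH b : b \in w |: B -> b \in H.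
  by rewrite in_setU1 => /orP[/eqP->//|/BHw]; rewrite !inE => /and3P[].
have CB b : b \in w |: B -> b \notin C.
  move=> bB; rewrite inE negb_and negbK; apply/orP; left.
  by apply/bigcupP; exists b => //; rewrite !inE eirr (BinH b bB).
have wB : w \notin B by apply/negP => /BHw; rewrite !inE eqxx.
have cwB : #|w |: B| = k.+1 by rewrite cardsU1 wB cB.
have cC : (#|H| <= 2 * #|C|)%N.
  have cover : (#|\bigcup_(b in w |: B) (H :\: nbr b)| <=
                #|H| %/ (2 * k.+1) * #|w |: B|)%N.
    apply: leq_card_bigcup => b bB.
    by rewrite leq_divRL // mulnC sparse ?BinH.
  have := cardsID (\bigcup_(b in w |: B) (H :\: nbr b)) H; rewrite -/C.
  have := leq_trans (subset_leq_card (subsetIr H _)) cover.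
  have := leq_trunc_div #|H| (2 * k.+1).
  rewrite cwB; nia.
have gBC : gram B C = k%:R * #|C|%:R.
  rewrite gramE mulr_natl -cB -sumr_const; apply: eq_bigr => b bB.
  by rewrite Cnbr ?(negPf (CB b _)) ?mulr0 ?addr0 // !inE bB orbT.
have gww : gram [set w] [set w] = l%:R.
  rewrite gram1l set11 mulr1 (_ : _ :&: _ = set0) ?cards0 ?add0r //.
  by apply/setP => x; rewrite !inE; case: eqP => [->|//]; rewrite eirr.
have gwB : gram [set w] B = 0.
  rewrite gram1l (negPf wB) mulr0 addr0 (_ : _ :&: _ = set0) ?cards0 //.
  apply/setP => x; rewrite !inE; case: (boolP (x \in B)) => //= /BHw.
  by rewrite !inE => /and3P[_ /negPf].
have gwC : gram [set w] C = #|C|%:R.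
  by rewrite gram1l Cnbr ?(negPf (CB w _)) ?mulr0 ?addr0 // setU11.
have kE : k%:R = 2 * l%:R ^+ 2 + 1 :> R by rewrite natrD natrM natrX.
have cC4 : 4 * k%:R <= #|C|%:R :> R by rewrite -natrM ler_nat; lia.
(* The coefficient of [C] projects away the barycentre of [C] up to [O(1 / #|C|)]. *)
have := gram_ge0 [set w] B C (k%:R / l%:R) 1 (- (k%:R / l%:R + k%:R) / #|C|%:R).
have := gram_le B; have := gram_le C; rewrite cB gww gwB gwC gBC.
move: (gram B B) (gram C C) => b c.
set t := k%:R / l%:R; set n := #|C|%:R; set g := - _ / n => cle ble.
have k0 : 0 < k%:R :> R by rewrite ltr0n; lia.
have n0 : 0 < n by apply: lt_le_trans cC4; rewrite mulr_gt0.
have tE : t * l%:R = k%:R by rewrite divfK // gt_eqF.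
have t0 : 0 < t by rewrite divr_gt0.
have tk : t <= k%:R by rewrite -tE ler_peMr ?ler1n // ltW.
have gE : g * n = - (t + k%:R) by rewrite divfK // gt_eqF.
(* As [t <= k] and [4 k <= #|C|], the diagonal terms of [C] contribute at most [l * k]. *)
have gn : g ^+ 2 * n <= k%:R.
  rewrite -(ler_pM2r n0) -mulrA -expr2 -exprMn gE sqrrN.
  apply: le_trans (_ : k%:R * (4 * k%:R) <= _); last by rewrite ler_wpM2l // ltW.
  rewrite expr2 (_ : _ * (4 * _) = (k%:R + k%:R) * (k%:R + k%:R)); last by ring.
  by rewrite ler_pM ?lerD2r // addr_ge0 // ltW.
have gc : g ^+ 2 * c <= (t + k%:R) ^+ 2 + l%:R * k%:R.
  apply: le_trans (ler_wpM2l (sqr_ge0 g) cle) _.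
  rewrite (_ : _ * _ = (g * n) ^+ 2 + l%:R * (g ^+ 2 * n)); last by ring.
  by rewrite gE sqrrN lerD2l ler_wpM2l // ltW.
have -> : t * g * n = - t * (t + k%:R) by rewrite -mulrA gE; ring.
have -> : 1 * g * (k%:R * n) = - k%:R * (t + k%:R).
  rewrite (_ : _ * (_ * _) = k%:R * (g * n)); last by ring.
  by rewrite gE; ring.
have t2 : t ^+ 2 * l%:R = t * k%:R by rewrite expr2 -mulrA tE.
rewrite t2 mulr0 => form_ge0.
(* The form has collapsed to [2 l k - t k - t ^ 2], so [t <= 2 l] and [k = t l <= 2 l ^ 2], a
   contradiction. *)
have : k%:R * t <= 2 * l%:R * k%:R by have := sqr_ge0 t; lra.
rewrite [leRHS]mulrC ler_pM2l // -(ler_pM2r lR_gt0) tE; lra.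
Qed.

(** By maximality, each vertex of [H] is a non-neighbour of some vertex of a maximal clique [K] (of
    itself if it lies in [K]), so [#|K|] sets of size at most [k] cover [H]. *)
Lemma clique_of_few_nonneighbours (H : {set V}) (k : nat) :
    (forall w, w \in H -> (#|H :\: nbr w| <= k)%N) ->
  exists2 K : {set V}, clique e K & (#|H| <= k * #|K|)%N.
Proof.
move=> few; pose P (K : {set V}) :=
  (K \subset H) && [forall x in K, forall y in K, (x != y) ==> e x y].
have [|K /maxsetP[/andP[/subsetP KH /forall_inP Kcl] Kmax]] := @ex_maxset _ P.
  exists set0; rewrite /P sub0set; apply/forall_inP => x; by rewrite inE.
have Kclique : clique e K.
  by move=> x y xK yK; apply/implyP; move/forall_inP: (Kcl x xK) => /(_ y yK).
exists K => //.
have cover : H \subset \bigcup_(x in K) (H :\: nbr x).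
  apply/subsetP => y yH; apply/bigcupP; case: (boolP (y \in K)) => yK.
    by exists y => //; rewrite !inE eirr yH.
  case: (boolP [exists x in K, ~~ e x y]) => [/exists_inP[x xK xy]|].
    by exists x => //; rewrite !inE xy.
  rewrite negb_exists_in => /forall_inP yadj.
  have := Kmax (y |: K); rewrite /P subsetUr => /(_ _ isT) yKE.
  suff : y \in K by rewrite (negPf yK).
  rewrite -yKE ?setU11 //; apply/andP; split.
    by apply/subsetP => x; rewrite !inE => /orP[/eqP->//|/KH].
  apply/forall_inP => x; rewrite in_setU1 => xK.
  apply/forall_inP => z; rewrite in_setU1 => zK; apply/implyP.
  case/orP: xK => [/eqP->|xK]; case/orP: zK => [/eqP->|zK].
  - by rewrite eqxx.
  - by move=> _; rewrite esym; move: (yadj z zK); rewrite negbK.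
  - by move=> _; move: (yadj x xK); rewrite negbK.
  - exact: Kclique.
apply: leq_trans (subset_leq_card cover) _.
apply: leq_card_bigcup => x xK; exact: few (KH x xK).
Qed.

Lemma clique_of_degree (v : V) (k := (2 * l ^ 2 + 1)%N)
    (D := (4 * l * k.+1)%N) (s := (16 * l * D + 1)%N) :
    (16 * l * k * D ^ s <= degree e v)%N ->
  exists2 K : {set V}, clique e K & (degree e v <= D ^ s * (2 * l * k) * #|K|)%N.
Proof.
rewrite -[degree e v]/#|nbr v| => bigN.
have D1 : (1 < D)%N by rewrite /D; nia.
have Ds0 : (0 < D ^ s)%N by rewrite expn_gt0; lia.
have k0 : (0 < k)%N by rewrite /k; lia.
have lD0 : 0 < 8 * l%:R * D%:R :> R by rewrite -!natrM ltr0n; nia.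
have N0 : 0 < #|nbr v|%:R :> R.
  by rewrite ltr0n (leq_trans _ bigN) // !muln_gt0 l_gt0 k0 Ds0.
have [||T [TN NT good]] := @energy_increment D s (nbr v) D1.
- by apply: leq_trans bigN; rewrite leq_mul2r; nia.
(* Since [s > 16 l D], the initial energy threshold is negative. *)
- have gN := gram_nbr_ge v (nbr v) (subxx _).
  apply: lt_le_trans (_ : 0 <= _); last first.
    by rewrite -(pmulr_rge0 _ lR_gt0) (le_trans _ gN) ?sqr_ge0.
  rewrite nmulr_rlt0 ?exprn_gt0 // subr_lt0 ltr_pdivlMr // /s.
  by rewrite -!natrM ltr_nat; lia.
have bigT : (16 * l * k <= #|T|)%N.
  by rewrite -(leq_pmul2r Ds0) (leq_trans bigN) // mulnC.
pose H := [set w in T | D * #|T :\: nbr w| <= #|T|]%N.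
have HT : H \subset T by apply/subsetP => w; rewrite inE => /andP[].
(* Vertices outside [H] have at most [#|T| / D] neighbours in [T], those of [H] at most [#|T|]. *)
have nbrT : (D * \sum_(u in T) #|T :&: nbr u| <= D * #|H| * #|T| + #|T| * #|T|)%N.
  rewrite big_distrr (big_setID H) /= (setIidPr HT) leq_add //.
    rewrite mulnAC mulnC -sum_nat_const; apply: leq_sum => u _.
    by rewrite leq_mul2l subset_leq_card ?orbT ?subsetIl.
  apply: leq_trans (_ : (#|T :\: H| * #|T| <= _)%N); last first.
    by rewrite leq_mul2r subset_leq_card ?orbT ?subsetDl.
  rewrite -sum_nat_const; apply: leq_sum => u /setDP[uT].
  by rewrite inE uT /=; case: (good u uT) => // ->.
have T0 : (0 < #|T|)%N by apply: leq_trans bigT; rewrite !muln_gt0 l_gt0.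
have TH : (#|T| <= 2 * l * #|H|)%N.
  have gramT : gram T T = (\sum_(u in T) #|T :&: nbr u| + l * #|T|)%N%:R.
    rewrite gramE big_split /= natrD natr_sum natrM; congr (_ + _).
    by rewrite mulr_natr -sumr_const; apply: eq_bigr => u ->; rewrite mulr1.
  (* [T] lies in the neighbourhood of [v], so it spans many edges; by the count above, most of these
     need [H]. *)
  have := gram_nbr_ge v T TN; rewrite gramT -natrX -natrM ler_nat => gT.
  have : (D * #|T| * #|T| <= l * (D * #|H| + #|T| + D * l) * #|T|)%N.
    have := leq_mul (leqnn D) gT; have := leq_mul (leqnn l) nbrT; nia.
  rewrite leq_pmul2r // => DT.
  have lk : (l <= k)%N by rewrite /k; nia.
  have Dl : (8 * l <= D)%N by rewrite /D; nia.
  have := leq_mul Dl (leqnn #|T|); have := leq_mul (leqnn D) bigT.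
  have : (D * (16 * l * l) <= D * (16 * l * k))%N by rewrite !leq_mul2l lk !orbT.
  move=> lk' DT' lT'; rewrite -(leq_pmul2l (ltnW D1)); clearbody s D k; lia.
have [w wH|K Kcl HK] := @clique_of_few_nonneighbours H k.
  apply: few_nonneighbours wH; first by rewrite -/k; nia.
  move=> {}w wH; have := wH; rewrite inE => /andP[_ sparse].
  (* [D = 4 l (k + 1)] absorbs the loss [2 l] in passing from [T] to [H]. *)
  have : (D * #|H :\: nbr w| <= 2 * l * #|H|)%N.
    apply: leq_trans TH; apply: leq_trans sparse.
    by rewrite leq_mul2l subset_leq_card ?orbT ?setSD.
  rewrite /D -/k; nia.
exists K => //; apply: leq_trans NT _; rewrite -mulnA leq_mul2l.
by apply/orP; right; apply: leq_trans TH _; rewrite -[leqRHS]mulnA leq_mul2l HK orbT.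
Qed.

End Gram.

(** * From the smallest eigenvalue to the clique bound *)

Lemma adjacency_form_ge0 (R : realType) (V : finType) (e : rel V) (mu : R) (l : nat) :
    symmetric e -> is_smallest_eigenvalue (adjacency_matrix R e) mu ->
    - l%:R <= mu ->
  forall x : V -> R,
    0 <= \sum_u \sum_v x u * x v * ((e u v)%:R + l%:R * (u == v)%:R).
Proof.
move=> esym [_ mu_min] lmu x.
have Asym : (adjacency_matrix R e)^T = adjacency_matrix R e.
  by apply/matrixP => i j; rewrite !mxE esym.
pose y : 'rV[R]_#|V| := \row_i x (enum_val i).
have sumE (F : V -> R) : \sum_u F u = \sum_(i < #|V|) F (enum_val i).
  by rewrite (reindex _ (onW_bij _ (enum_val_bij V))).
have normE : (y *m y^T) 0 0 = \sum_u x u ^+ 2.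
  by rewrite mxE sumE; apply: eq_bigr => i _; rewrite !mxE expr2.
have formE : (y *m adjacency_matrix R e *m y^T) 0 0
    = \sum_u \sum_v x u * x v * (e u v)%:R.
  rewrite exchange_big mxE sumE; apply: eq_bigr => j _.
  rewrite !mxE mulr_suml sumE; apply: eq_bigr => i _; rewrite !mxE.
  by rewrite mulrAC.
have -> : \sum_u \sum_v x u * x v * ((e u v)%:R + l%:R * (u == v)%:R)
    = (y *m adjacency_matrix R e *m y^T) 0 0 + l%:R * (y *m y^T) 0 0.
  rewrite formE normE mulr_sumr -big_split /=; apply: eq_bigr => u _.
  transitivity (\sum_v (x u * x v * (e u v)%:R + l%:R * (x u * x v * (u == v)%:R))).
    by apply: eq_bigr => v _; rewrite mulrDr; congr (_ + _); rewrite mulrCA.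
  rewrite big_split /=; congr (_ + _); rewrite -mulr_sumr; congr (_ * _).
  rewrite (bigD1 u) //= eqxx mulr1 big1 ?addr0 ?expr2 // => v /negPf vu.
  by rewrite eq_sym vu mulr0.
have := symmetric_form_ge R _ _ _ Asym mu_min y.
have : 0 <= (y *m y^T) 0 0 by rewrite normE sumr_ge0 // => u _; apply: sqr_ge0.
by move: lmu; nra.
Qed.

Lemma average_degree_le (R : realType) (V : finType) (e : rel V) (v : V) :
    (forall w, (degree e w <= degree e v)%N) ->
  average_degree R e <= (degree e v)%:R.
Proof.
move=> vmax; rewrite ler_pdivrMr ?ltr0n; last by apply/card_gt0P; exists v.
rewrite -natrM ler_nat mulnC -sum_nat_const; exact: leq_sum.
Qed.

Theorem theorem2p4 (R : realType) (lambda : R) (hlambda : 0 < lambda) :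
  exists2 c : R, 0 < c &
    forall (V : finType) (e : rel V) (mu : R),
      simple_graph e ->
      is_smallest_eigenvalue (adjacency_matrix R e) mu ->
      - lambda <= mu ->
      exists2 K : {set V}, clique e K & c * average_degree R e <= #|K|%:R.
Proof.
pose l := Num.bound lambda.
have ll : lambda < l%:R by apply: archi_boundP; apply: ltW.
have l0 : (0 < l)%N by rewrite -(ltr0n R); apply: lt_trans ll.
pose k := (2 * l ^ 2 + 1)%N; pose D := (4 * l * k.+1)%N.
pose s := (16 * l * D + 1)%N; pose N := (16 * l * k * D ^ s)%N.
have k0 : (0 < k)%N by rewrite /k addn1.
have Ds0 : (0 < D ^ s)%N by rewrite expn_gt0 !muln_gt0 l0.
have N0 : (0 < N)%N by rewrite muln_gt0 Ds0 andbT !muln_gt0 l0 k0.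
(* [N] is the degree threshold of [clique_of_degree] and also dominates the factor in its
   conclusion. *)
exists N%:R^-1 => [|V e mu [esym eirr] smallest lmu].
  by rewrite invr_gt0 ltr0n.
have psd : forall x : V -> R, 0 <= \sum_u \sum_v
    x u * x v * ((e u v)%:R + l%:R * (u == v)%:R).
  apply: adjacency_form_ge0 esym smallest _.
  by apply: le_trans lmu; rewrite lerN2 ltW.
(* Without vertices the average degree is [0] by convention, and the empty clique works. *)
case: (pickP (@predT V)) => [v0 _|V0]; last first.
  exists set0; first by move=> x; rewrite inE.
  by rewrite /average_degree [#|V|]eq_card0 // invr0 !mulr0.
have [v _ vmax] := @arg_maxnP _ v0 predT (degree e) isT.
have [K Kcl vK] : exists2 K : {set V}, clique e K & (degree e v <= N * #|K|)%N.
  have [bigv|smallv] := leqP N (degree e v).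
    have [K Kcl vK] := clique_of_degree R V e l esym eirr psd l0 v bigv.
    by exists K => //; apply: leq_trans vK _; rewrite leq_mul2r /N -/k -/D -/s; nia.
  (* Below the threshold a single vertex suffices. *)
  exists [set v]; first by move=> x y /set1P-> /set1P->; rewrite eqxx.
  by rewrite cards1 muln1 ltnW.
exists K => //; rewrite mulrC ler_pdivrMr ?ltr0n // mulrC -natrM.
apply: le_trans (_ : (degree e v)%:R <= _); last by rewrite ler_nat.
by apply: average_degree_le => w; apply: vmax.
Qed.
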